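(* Let $\mathcal M$ be a minimal space-like surface of general type in $\mathbb R^4_1$, parameterized by canonical coordinates $(u,v)$ of the first type, $t=u+\mathrm i v$, and given by the canonical Weierstrass representation, i.e. $\Phi=\mathrm x_u-\mathrm i\,\mathrm x_v=(\phi_1,\phi_2,\phi_3,\phi_4)$ with $$\phi_1=\frac{\mathrm i}{2}\,\frac{g_1g_2+1}{\sqrt{g_1'g_2'}},\quad \phi_2=\frac12\,\frac{g_1g_2-1}{\sqrt{g_1'g_2'}},\quad \phi_3=\frac12\,\frac{g_1+g_2}{\sqrt{g_1'g_2'}},\quad \phi_4=\frac12\,\frac{g_1-g_2}{\sqrt{g_1'g_2'}},$$ where $g_1,g_2$ are holomorphic functions of $t$ with $g_1'g_2'\ne0$ and $g_1\bar g_2\neq-1$ everywhere. Then the coefficients $E=\mathrm x_u^2$, $G=\mathrm x_v^2$ of the first fundamental form are $$E=G=\frac{|1+g_1\bar g_2|^2}{4|g_1'g_2'|},$$ and the Gauss curvature $K$ and the curvature $\varkappa$ of the normal connection are $$K=\operatorname{Re}\frac{-16|g_1'g_2'|\,g_1'\overline{g_2'}}{|1+g_1\bar g_2|^2(1+g_1\bar g_2)^2},\qquad \varkappa=\operatorname{Im}\frac{-16|g_1'g_2'|\,g_1'\overline{g_2'}}{|1+g_1\bar g_2|^2(1+g_1\bar g_2)^2}.$$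
   Context: $\mathbb R^4_1$ is $\mathbb R^4$ with the indefinite product $a\cdot b=a_1b_1+a_2b_2+a_3b_3-a_4b_4$ and its standard orientation; the product is extended bilinearly to $\mathbb C^4$ and $a^2=a\cdot a$. A surface $\mathcal M$ given by an immersion $\mathrm x$ is space-like if the induced metric on each tangent space $T_p(\mathcal M)$ is positive definite; $N_p(\mathcal M)$ is the normal space (signature $(1,1)$). The second fundamental form is $\sigma(X,Y)=(\nabla_XY)^\bot$, where $\nabla$ is the flat connection and $\bot$ is the projection to the normal space. The surface is minimal if $H=\frac12\operatorname{trace}\sigma=0$. It is of general type if it has no degenerate points, a point $p$ being degenerate if $\{\sigma(X,Y):X,Y\in T_p(\mathcal M)\}$ is contained in one of the two light-like one-dimensional subspaces of $N_p(\mathcal M)$. Coordinates $(u,v)$ are isothermal if $\mathrm x_u^2=\mathrm x_v^2$ and $\mathrm x_u\cdot\mathrm x_v=0$. Put $X_1=\mathrm x_u/\sqrt E$, $X_2=\mathrm x_v/\sqrt E$. Isothermal coordinates on a minimal space-like surface are canonical of the first type if $\sigma(X_1,X_1)\perp\sigma(X_1,X_2)$ and $E^2(\sigma(X_1,X_1)^2-\sigma(X_1,X_2)^2)=1$; equivalently $\Phi'^2=1$. $\sqrt{g_1'g_2'}$ denotes a holomorphic branch of the square root. $K$ is the Gauss curvature of the induced metric, so that $K=\sigma(X_1,X_1)\cdot\sigma(X_2,X_2)-\sigma(X_1,X_2)^2$. For the normal curvature, choose an orthonormal normal frame $n_1,n_2$ with $n_1^2=1$, $n_2^2=-1$ such that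 $(X_1,X_2,n_1,n_2)$ is positively oriented in $\mathbb R^4_1$, and for a normal vector $n$ let $A_n$ be the Weingarten operator, $A_nX\cdot Y=\sigma(X,Y)\cdot n$. Then $\varkappa=R^N(X_1,X_2)n_2\cdot n_1$, where $R^N$ is the curvature tensor of the normal connection, with sign convention such that $\varkappa=A_{n_1}X_1\cdot A_{n_2}X_2-A_{n_2}X_1\cdot A_{n_1}X_2$. *)

(* Defs.v *)
From Stdlib Require Import Reals.
From Coquelicot Require Export Coquelicot.
Open Scope R_scope.

Record V4 : Set := mkV4 { c1 : R; c2 : R; c3 : R; c4 : R }.

Definition vzero : V4 := mkV4 0 0 0 0.
Definition vadd (a b : V4) : V4 :=
  mkV4 (c1 a + c1 b) (c2 a + c2 b) (c3 a + c3 b) (c4 a + c4 b).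
Definition vscal (k : R) (a : V4) : V4 :=
  mkV4 (k * c1 a) (k * c2 a) (k * c3 a) (k * c4 a).
Definition vsub (a b : V4) : V4 := vadd a (vscal (-1) b).

Definition dot (a b : V4) : R :=
  c1 a * c1 b + c2 a * c2 b + c3 a * c3 b - c4 a * c4 b.

Definition det3 (a1 a2 a3 b1 b2 b3 d1 d2 d3 : R) : R :=
  a1 * (b2 * d3 - b3 * d2) - a2 * (b1 * d3 - b3 * d1) + a3 * (b1 * d2 - b2 * d1).

(* Laplace expansion along the first row of the matrix with rows a, b, c, d. *)
Definition det4 (a b c d : V4) : R :=
  c1 a * det3 (c2 b) (c3 b) (c4 b) (c2 c) (c3 c) (c4 c) (c2 d) (c3 d) (c4 d)
  - c2 a * det3 (c1 b) (c3 b) (c4 b) (c1 c) (c3 c) (c4 c) (c1 d) (c3 d) (c4 d)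
  + c3 a * det3 (c1 b) (c2 b) (c4 b) (c1 c) (c2 c) (c4 c) (c1 d) (c2 d) (c4 d)
  - c4 a * det3 (c1 b) (c2 b) (c3 b) (c1 c) (c2 c) (c3 c) (c1 d) (c2 d) (c3 d).

(* A set of parameters (u,v) is given as a set of complex numbers
   t = u + i v, since C = R * R. *)

Inductive coord : Set := cu | cv.

Definition sum2 (f : coord -> R) : R := f cu + f cv.
Definition vsum2 (f : coord -> V4) : V4 := vadd (f cu) (f cv).

Definition pd (i : coord) (f : R -> R -> R) (u v : R) : R :=
  match i with
  | cu => Derive (fun s => f s v) u
  | cv => Derive (fun s => f u s) v
  end.

Definition vpd (i : coord) (f : R -> R -> V4) (u v : R) : V4 :=
  mkV4 (pd i (fun s t => c1 (f s t)) u v) (pd i (fun s t => c2 (f s t)) u v)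
       (pd i (fun s t => c3 (f s t)) u v) (pd i (fun s t => c4 (f s t)) u v).

Fixpoint class_C (k : nat) (D : C -> Prop) (f : R -> R -> R) : Prop :=
  match k with
  | O => forall u v, D (u, v) -> continuity_2d_pt f u v
  | S k' =>
      (forall u v, D (u, v) ->
         ex_derive (fun s => f s v) u /\ ex_derive (fun s => f u s) v) /\
      (forall i, class_C k' D (pd i f))
  end.

Definition smooth (D : C -> Prop) (f : R -> R -> R) : Prop :=
  forall k, class_C k D f.

Definition vsmooth (D : C -> Prop) (f : R -> R -> V4) : Prop :=
  smooth D (fun u v => c1 (f u v)) /\ smooth D (fun u v => c2 (f u v)) /\
  smooth D (fun u v => c3 (f u v)) /\ smooth D (fun u v => c4 (f u v)).

Definition holomorphic (D : C -> Prop) (f : C -> C) : Prop :=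
  forall z : C, D z -> ex_derive f z.

Section Metric.

Variable g : coord -> coord -> R -> R -> R.

Definition gdet (u v : R) : R :=
  g cu cu u v * g cv cv u v - g cu cv u v * g cv cu u v.

Definition ginv (i j : coord) (u v : R) : R :=
  match i, j with
  | cu, cu => g cv cv u v / gdet u v
  | cv, cv => g cu cu u v / gdet u v
  | _, _ => - g i j u v / gdet u v
  end.

(* The coefficient Gamma^k_{ij} of the Levi-Civita connection. *)
Definition christoffel (k i j : coord) (u v : R) : R :=
  / 2 * sum2 (fun l => ginv k l u v *
    (pd i (g j l) u v + pd j (g i l) u v - pd l (g i j) u v)).

(* The l-th component of R(d_u, d_v) d_v, where
   R(X,Y) = [nabla_X, nabla_Y] - nabla_[X,Y]. *)
Definition riemann_uvv (l : coord) (u v : R) : R :=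
  pd cu (christoffel l cv cv) u v - pd cv (christoffel l cu cv) u v
  + sum2 (fun m => christoffel m cv cv u v * christoffel l cu m u v
                 - christoffel m cu cv u v * christoffel l cv m u v).

(* g(R(d_u, d_v) d_v, d_u) / (g(d_u,d_u) g(d_v,d_v) - g(d_u,d_v)^2). *)
Definition gauss_curvature (u v : R) : R :=
  sum2 (fun l => riemann_uvv l u v * g l cu u v) / gdet u v.

End Metric.

(* A tangent vector at the point x(u,v) is given by its components in the basis
   (x_u, x_v). *)

Section Surface.

Variable x : R -> R -> V4.

Definition metric (i j : coord) (u v : R) : R := dot (vpd i x u v) (vpd j x u v).

Definition coefE : R -> R -> R := metric cu cu.
Definition coefF : R -> R -> R := metric cu cv.
Definition coefG : R -> R -> R := metric cv cv.

Definition dx (u v : R) (X : coord -> R) : V4 :=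
  vsum2 (fun i => vscal (X i) (vpd i x u v)).

Definition is_tangent (u v : R) (w : V4) : Prop := exists X, w = dx u v X.
Definition is_normal (u v : R) (n : V4) : Prop :=
  forall w, is_tangent u v w -> dot n w = 0.

Definition immersion_at (u v : R) : Prop :=
  forall X, dx u v X = vzero -> forall i, X i = 0.

Definition space_like_at (u v : R) : Prop :=
  forall w, is_tangent u v w -> w <> vzero -> 0 < dot w w.

(* Orthogonal projection to the normal space, by means of the inverse Gram
   matrix of (x_u, x_v). *)
Definition normal_part (u v : R) (w : V4) : V4 :=
  vsub w (vsum2 (fun i => vsum2 (fun j =>
    vscal (ginv metric i j u v * dot w (vpd i x u v)) (vpd j x u v)))).

(* The flat connection; Y is a vector field along x. *)
Definition nabla (X : coord -> R) (Y : R -> R -> V4) (u v : R) : V4 :=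
  vsum2 (fun i => vscal (X i) (vpd i Y u v)).

(* (nabla_X Y)^bot is tensorial in Y: the tangent vector Y is extended to the
   tangent field with constant components in the basis (x_u, x_v). *)
Definition sigma (u v : R) (X Y : coord -> R) : V4 :=
  normal_part u v (nabla X (fun s t => dx s t Y) u v).

Definition cbasis (i : coord) : coord -> R :=
  fun j => match i, j with cu, cu => 1 | cv, cv => 1 | _, _ => 0 end.

Definition mean_curvature (u v : R) : V4 :=
  vscal (/ 2) (vsum2 (fun i => vsum2 (fun j =>
    vscal (ginv metric i j u v) (sigma u v (cbasis i) (cbasis j))))).

Definition degenerate_at (u v : R) : Prop :=
  exists l : V4, is_normal u v l /\ l <> vzero /\ dot l l = 0 /\
    forall X Y, exists k : R, sigma u v X Y = vscal k l.

Definition isothermal_at (u v : R) : Prop :=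
  coefE u v = coefG u v /\ coefF u v = 0.

Definition X1 (u v : R) : coord -> R :=
  fun i => match i with cu => / sqrt (coefE u v) | cv => 0 end.
Definition X2 (u v : R) : coord -> R :=
  fun i => match i with cu => 0 | cv => / sqrt (coefE u v) end.

Definition canonical_first_type_at (u v : R) : Prop :=
  let s11 := sigma u v (X1 u v) (X1 u v) in
  let s12 := sigma u v (X1 u v) (X2 u v) in
  isothermal_at u v /\ dot s11 s12 = 0 /\
  coefE u v ^ 2 * (dot s11 s11 - dot s12 s12) = 1.

Definition nabla_normal (X : coord -> R) (n : R -> R -> V4) (u v : R) : V4 :=
  normal_part u v (nabla X n u v).

(* R^N(X,Y)n = D_X D_Y n - D_Y D_X n - D_[X,Y] n, with X and Y extended with
   constant components in the coordinate basis, so that [X,Y] = 0. *)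
Definition RN (X Y : coord -> R) (n : R -> R -> V4) (u v : R) : V4 :=
  vsub (nabla_normal X (nabla_normal Y n) u v)
       (nabla_normal Y (nabla_normal X n) u v).

Definition oriented_normal_frame (U : C -> Prop) (n1 n2 : R -> R -> V4) : Prop :=
  vsmooth U n1 /\ vsmooth U n2 /\
  forall u v, U (u, v) ->
    is_normal u v (n1 u v) /\ is_normal u v (n2 u v) /\
    dot (n1 u v) (n1 u v) = 1 /\ dot (n2 u v) (n2 u v) = -1 /\
    dot (n1 u v) (n2 u v) = 0 /\
    0 < det4 (dx u v (X1 u v)) (dx u v (X2 u v)) (n1 u v) (n2 u v).

Definition normal_curvature (n1 n2 : R -> R -> V4) (u v : R) : R :=
  dot (RN (X1 u v) (X2 u v) n2 u v) (n1 u v).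

(* A component of Phi = x_u - i x_v. *)
Definition phi (c : V4 -> R) (u v : R) : C :=
  (RtoC (c (vpd cu x u v)) - Ci * RtoC (c (vpd cv x u v)))%C.

(* s is the branch of sqrt(g1' g2'). *)
Definition canonical_weierstrass_at (g1 g2 s : C -> C) (u v : R) : Prop :=
  let t : C := (u, v) in
  (phi c1 u v = Ci / 2 * ((g1 t * g2 t + 1) / s t) /\
   phi c2 u v = 1 / 2 * ((g1 t * g2 t - 1) / s t) /\
   phi c3 u v = 1 / 2 * ((g1 t + g2 t) / s t) /\
   phi c4 u v = 1 / 2 * ((g1 t - g2 t) / s t))%C.

End Surface.

Definition minimal_space_like_general_type
    (D : C -> Prop) (x : R -> R -> V4) : Prop :=
  vsmooth D x /\
  forall u v, D (u, v) ->
    immersion_at x u v /\ space_like_at x u v /\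
    mean_curvature x u v = vzero /\ ~ degenerate_at x u v.

Definition holomorphic_sqrt (D : C -> Prop) (s f : C -> C) : Prop :=
  holomorphic D s /\ forall z, D z -> (s z * s z = f z)%C.

(* Main.v *)
Require Import Defs.
From Stdlib Require Import Reals Lra Psatz.
From Coquelicot Require Import Coquelicot.
(* Reals has another c1, which must not hide the coordinate function. *)
Import Defs.
Open Scope R_scope.

(** The formulas are read off from Phi = x_u - i x_v and its derivative alone.

    Write psi = s Phi for the polynomial numerator of the Weierstrass
    representation, where s is the branch of the root of g1' g2'. Since g1, g2
    and s are holomorphic and x is smooth, differentiating s Phi = psi gives the
    Cauchy-Riemann equations for Phi, hence x_vv = - x_uu, and
    Phi' = x_uu - i x_uv = psi'/s - (s'/s) Phi ([weierstrass_derivatives]).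

    The vector psi is isotropic with psi . conj psi = |p|^2 / 2, where
    p = 1 + g1 conj g2, so the coordinates are isothermal with
    E = |p|^2 / (4 |s|^2) and |s|^2 = |g1' g2'|. Both curvatures are then
    expressed by Phi and Phi':
    - K = - L(Phi, Phi') / E^3, where L(Phi, Phi') is half of the Hermitian Gram
      determinant of Phi and Phi'. This comes from K = - (log E)_laplace / (2E)
      and the harmonicity of x ([gauss_curvature_harmonic]).
    - kappa = - 2 det(x_u, x_v, x_uu, x_uv) / E^3. Differentiating the normal
      connection gives kappa in terms of the products of x_uu and x_uv with the
      normal frame, and the orientation of the frame turns these into a
      determinant ([normal_curvature_isothermal], [normal_curvature_det]).

    Both L and the determinant are multiplied by |q|^4 when (Phi, Phi') is
    replaced by (q Phi, q Phi' + r q Phi) ([half_gram_turn], [det4_turn]). Hence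
    the unknown s' disappears, and it remains to evaluate them on psi and psi':
    they are the real part of w / 4 and the imaginary part of w / 8, with
    w = g1' conj g2' (conj p)^2 ([num_identities]). *)

(** * Partial derivatives of real functions, of vector fields and of complex functions *)

Definition is_pd (i : coord) (f : R -> R -> R) (u v l : R) : Prop :=
  match i with
  | cu => is_derive (fun s => f s v) u l
  | cv => is_derive (fun s => f u s) v l
  end.

Lemma is_pd_unique i f u v l : is_pd i f u v l -> pd i f u v = l.
Proof. destruct i; apply is_derive_unique. Qed.

Lemma is_pd_const i k u v : is_pd i (fun _ _ => k) u v 0.
Proof. destruct i; simpl; apply @is_derive_const. Qed.

Lemma is_pd_plus i f g u v a b :
  is_pd i f u v a -> is_pd i g u v b ->
  is_pd i (fun s t => f s t + g s t) u v (a + b).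
Proof. destruct i; simpl; intros; now apply @is_derive_plus. Qed.

Lemma is_pd_minus i f g u v a b :
  is_pd i f u v a -> is_pd i g u v b ->
  is_pd i (fun s t => f s t - g s t) u v (a - b).
Proof. destruct i; simpl; intros; now apply @is_derive_minus. Qed.

Lemma is_pd_mult i f g u v a b :
  is_pd i f u v a -> is_pd i g u v b ->
  is_pd i (fun s t => f s t * g s t) u v (a * g u v + f u v * b).
Proof.
  destruct i; simpl; intros.
  - apply (is_derive_mult (fun s => f s v) (fun s => g s v)); trivial; apply Rmult_comm.
  - apply (is_derive_mult (fun s => f u s) (fun s => g u s)); trivial; apply Rmult_comm.
Qed.

Lemma is_pd_div i f g u v a b :
  is_pd i f u v a -> is_pd i g u v b -> g u v <> 0 ->
  is_pd i (fun s t => f s t / g s t) u v ((a * g u v - f u v * b) / g u v ^ 2).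
Proof.
  destruct i; simpl; intros.
  - now apply (is_derive_div (fun s => f s v) (fun s => g s v)).
  - now apply (is_derive_div (fun s => f u s) (fun s => g u s)).
Qed.

Lemma open_locally_2d (D : C -> Prop) u v :
  open (T := C_UniformSpace) D -> D (u, v) ->
  locally_2d (fun s t => D (s, t)) u v.
Proof.
  intros hD h. apply locally_2d_locally.
  destruct (hD (u, v) h) as [d Hd]. exists d. intros [s t] Hy. now apply Hd.
Qed.

Lemma is_pd_ext D i f g u v l :
  open (T := C_UniformSpace) D -> D (u, v) ->
  (forall s t, D (s, t) -> f s t = g s t) ->
  is_pd i f u v l -> is_pd i g u v l.
Proof.
  intros hD h e. pose proof (open_locally_2d D u v hD h) as [d Hd].
  destruct i; simpl; apply is_derive_ext_loc; exists d; intros y hy; apply e, Hd.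
  - exact hy.
  - rewrite Rminus_eq_0, Rabs_R0. apply cond_pos.
  - rewrite Rminus_eq_0, Rabs_R0. apply cond_pos.
  - exact hy.
Qed.

Lemma pd_ext D i f g u v :
  open (T := C_UniformSpace) D -> D (u, v) ->
  (forall s t, D (s, t) -> f s t = g s t) ->
  pd i f u v = pd i g u v.
Proof.
  intros hD h e. pose proof (open_locally_2d D u v hD h) as [d Hd].
  destruct i; simpl; apply Derive_ext_loc; exists d; intros y hy; apply e, Hd.
  - exact hy.
  - rewrite Rminus_eq_0, Rabs_R0. apply cond_pos.
  - rewrite Rminus_eq_0, Rabs_R0. apply cond_pos.
  - exact hy.
Qed.

Lemma smooth_is_pd D f i u v :
  smooth D f -> D (u, v) -> is_pd i f u v (pd i f u v).
Proof.
  intros hf h. destruct (proj1 (hf 1%nat) u v h) as [hu hv].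
  destruct i; simpl; now apply Derive_correct.
Qed.

Lemma smooth_pd D f i : smooth D f -> smooth D (pd i f).
Proof. intros hf k. apply (proj2 (hf (S k))). Qed.

Lemma smooth_pd_comm D f u v :
  open (T := C_UniformSpace) D -> D (u, v) -> smooth D f ->
  pd cu (pd cv f) u v = pd cv (pd cu f) u v.
Proof.
  intros hD h hf. simpl. apply Schwarz.
  - destruct (open_locally_2d D u v hD h) as [d Hd]. exists d. intros s t hs ht.
    specialize (Hd s t hs ht).
    destruct (proj1 (hf 1%nat) s t Hd) as [hu hv].
    destruct (proj1 (smooth_pd D f cu hf 1%nat) s t Hd).
    destruct (proj1 (smooth_pd D f cv hf 1%nat) s t Hd).
    tauto.
  - apply (smooth_pd D _ cu (smooth_pd D f cv hf) 0%nat _ _ h).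
  - apply (smooth_pd D _ cv (smooth_pd D f cu hf) 0%nat _ _ h).
Qed.

Definition is_vpd (i : coord) (f : R -> R -> V4) (u v : R) (w : V4) : Prop :=
  is_pd i (fun s t => c1 (f s t)) u v (c1 w) /\
  is_pd i (fun s t => c2 (f s t)) u v (c2 w) /\
  is_pd i (fun s t => c3 (f s t)) u v (c3 w) /\
  is_pd i (fun s t => c4 (f s t)) u v (c4 w).

Lemma is_vpd_unique i f u v w : is_vpd i f u v w -> vpd i f u v = w.
Proof.
  intros (h1 & h2 & h3 & h4). destruct w. unfold vpd. f_equal; now apply is_pd_unique.
Qed.

Lemma is_vpd_add i f g u v a b :
  is_vpd i f u v a -> is_vpd i g u v b ->
  is_vpd i (fun s t => vadd (f s t) (g s t)) u v (vadd a b).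
Proof.
  intros (h1 & h2 & h3 & h4) (k1 & k2 & k3 & k4).
  repeat split; now apply is_pd_plus.
Qed.

Lemma is_vpd_scal i k f u v a b :
  is_pd i k u v a -> is_vpd i f u v b ->
  is_vpd i (fun s t => vscal (k s t) (f s t)) u v
    (vadd (vscal a (f u v)) (vscal (k u v) b)).
Proof.
  intros h (h1 & h2 & h3 & h4). repeat split; now apply (is_pd_mult i k).
Qed.

Lemma is_pd_dot i f g u v a b :
  is_vpd i f u v a -> is_vpd i g u v b ->
  is_pd i (fun s t => dot (f s t) (g s t)) u v (dot a (g u v) + dot (f u v) b).
Proof.
  intros (h1 & h2 & h3 & h4) (k1 & k2 & k3 & k4). unfold dot.
  pose proof (is_pd_minus _ _ _ _ _ _ _ (is_pd_plus _ _ _ _ _ _ _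
    (is_pd_plus _ _ _ _ _ _ _ (is_pd_mult _ _ _ _ _ _ _ h1 k1)
      (is_pd_mult _ _ _ _ _ _ _ h2 k2)) (is_pd_mult _ _ _ _ _ _ _ h3 k3))
    (is_pd_mult _ _ _ _ _ _ _ h4 k4)) as h.
  match goal with |- is_pd _ _ _ _ ?l => match type of h with is_pd _ _ _ _ ?m =>
    replace l with m by ring end end.
  exact h.
Qed.

Lemma vpd_ext D i f g u v :
  open (T := C_UniformSpace) D -> D (u, v) ->
  (forall s t, D (s, t) -> f s t = g s t) ->
  vpd i f u v = vpd i g u v.
Proof.
  intros hD h e. unfold vpd.
  f_equal; apply (pd_ext D); trivial; intros s t hst; now rewrite e.
Qed.

Lemma vsmooth_is_vpd D f i u v :
  vsmooth D f -> D (u, v) -> is_vpd i f u v (vpd i f u v).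
Proof.
  intros (h1 & h2 & h3 & h4) h.
  repeat split; simpl;
    [apply (smooth_is_pd D (fun s t => c1 (f s t)))
    |apply (smooth_is_pd D (fun s t => c2 (f s t)))
    |apply (smooth_is_pd D (fun s t => c3 (f s t)))
    |apply (smooth_is_pd D (fun s t => c4 (f s t)))]; trivial.
Qed.

Lemma vsmooth_vpd D f i : vsmooth D f -> vsmooth D (vpd i f).
Proof.
  intros (h1 & h2 & h3 & h4). repeat split;
    [apply (smooth_pd D (fun s t => c1 (f s t)))
    |apply (smooth_pd D (fun s t => c2 (f s t)))
    |apply (smooth_pd D (fun s t => c3 (f s t)))
    |apply (smooth_pd D (fun s t => c4 (f s t)))]; trivial.
Qed.

Lemma vpd_comm D f u v :
  open (T := C_UniformSpace) D -> D (u, v) -> vsmooth D f ->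
  vpd cu (vpd cv f) u v = vpd cv (vpd cu f) u v.
Proof.
  intros hD h (h1 & h2 & h3 & h4). unfold vpd at 1 3.
  f_equal; simpl c1; simpl c2; simpl c3; simpl c4;
    apply (smooth_pd_comm D); trivial.
Qed.

(** * The Cauchy-Riemann equations *)

Definition is_cpd (i : coord) (f : R -> R -> C) (u v : R) (l : C) : Prop :=
  is_pd i (fun s t => Re (f s t)) u v (Re l) /\
  is_pd i (fun s t => Im (f s t)) u v (Im l).

Lemma is_cpd_unique i f u v a b : is_cpd i f u v a -> is_cpd i f u v b -> a = b.
Proof.
  intros [h1 h2] [k1 k2].
  apply is_pd_unique in h1, h2, k1, k2. destruct a, b; simpl in *. congruence.
Qed.

Lemma is_cpd_const i k u v : is_cpd i (fun _ _ => k) u v (RtoC 0).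
Proof. split; apply is_pd_const. Qed.

Lemma is_cpd_plus i f g u v a b :
  is_cpd i f u v a -> is_cpd i g u v b ->
  is_cpd i (fun s t => (f s t + g s t)%C) u v (a + b)%C.
Proof. intros [h1 h2] [k1 k2]. split; now apply is_pd_plus. Qed.

Lemma is_cpd_minus i f g u v a b :
  is_cpd i f u v a -> is_cpd i g u v b ->
  is_cpd i (fun s t => (f s t - g s t)%C) u v (a - b)%C.
Proof. intros [h1 h2] [k1 k2]. split; now apply is_pd_minus. Qed.

Lemma is_cpd_mult i f g u v a b :
  is_cpd i f u v a -> is_cpd i g u v b ->
  is_cpd i (fun s t => (f s t * g s t)%C) u v (a * g u v + f u v * b)%C.
Proof.
  intros [h1 h2] [k1 k2]. split.
  - pose proof (is_pd_minus _ _ _ _ _ _ _ (is_pd_mult _ _ _ _ _ _ _ h1 k1)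
      (is_pd_mult _ _ _ _ _ _ _ h2 k2)) as h. simpl in h.
    match goal with |- is_pd _ _ _ _ ?l => match type of h with is_pd _ _ _ _ ?m =>
      replace l with m by (simpl; unfold Re, Im; ring) end end. exact h.
  - pose proof (is_pd_plus _ _ _ _ _ _ _ (is_pd_mult _ _ _ _ _ _ _ h1 k2)
      (is_pd_mult _ _ _ _ _ _ _ h2 k1)) as h. simpl in h.
    match goal with |- is_pd _ _ _ _ ?l => match type of h with is_pd _ _ _ _ ?m =>
      replace l with m by (simpl; unfold Re, Im; ring) end end. exact h.
Qed.

Lemma is_cpd_ext D i f g u v l :
  open (T := C_UniformSpace) D -> D (u, v) ->
  (forall s t, D (s, t) -> f s t = g s t) ->
  is_cpd i f u v l -> is_cpd i g u v l.
Proof.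
  intros hD h e [h1 h2].
  split; [revert h1|revert h2]; apply (is_pd_ext D); trivial; intros s t hst; now rewrite e.
Qed.

(** The direction in which the parameter t = u + i v moves with a coordinate. *)
Definition direction (i : coord) : C := match i with cu => RtoC 1 | cv => Ci end.

(** Restricting the complex difference quotient to the line z + R e multiplies the
    derivative by e; L is meant to be the real or the imaginary part. *)
Lemma is_derive_along_line (f : C -> C) (L : C -> R) (a : R) (e z l : C) :
  (forall w w', L (w - w')%C = L w - L w') -> (forall (k : R) w, L (RtoC k * w)%C = k * L w) ->
  (forall w, Rabs (L w) <= Cmod w) -> Cmod e = 1 ->
  is_derive f z l ->
  is_derive (fun h => L (f (z + RtoC (h - a) * e)%C)) a (L (e * l)%C).
Proof.
  intros Lsub Lscal Lb he [_ hd].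
  split. { apply is_linear_scal_l. }
  intros x hx. apply (is_filter_lim_locally_unique (V := R_NormedModule)) in hx. subst x.
  intros eps. specialize (hd z (fun P h => h) eps).
  (* Passes from the neighbourhoods given by the modulus to products of intervals. *)
  apply locally_C in hd. destruct hd as [d hd].
  exists d. intros h hh.
  assert (E0 : (z + RtoC (a - a) * e)%C = z).
  { apply injective_projections; simpl; ring. }
  specialize (hd (z + RtoC (h - a) * e)%C).
  assert (he1 : Rabs (fst e) <= 1) by (rewrite <- he; eapply Rle_trans; [apply Rmax_l|apply Rmax_Cmod]).
  assert (he2 : Rabs (snd e) <= 1) by (rewrite <- he; eapply Rle_trans; [apply Rmax_r|apply Rmax_Cmod]).
  change (Rabs (h - a) < d) in hh.
  assert (hb : ball (M := C_UniformSpace) z d (z + RtoC (h - a) * e)%C).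
  { split.
    - change (Rabs (fst z + ((h - a) * fst e - 0 * snd e) - fst z) < d).
      replace (fst z + ((h - a) * fst e - 0 * snd e) - fst z) with ((h - a) * fst e) by ring.
      rewrite Rabs_mult. pose proof (Rabs_pos (h - a)). pose proof (Rabs_pos (fst e)). nra.
    - change (Rabs (snd z + ((h - a) * snd e + 0 * fst e) - snd z) < d).
      replace (snd z + ((h - a) * snd e + 0 * fst e) - snd z) with ((h - a) * snd e) by ring.
      rewrite Rabs_mult. pose proof (Rabs_pos (h - a)). pose proof (Rabs_pos (snd e)). nra. }
  specialize (hd hb).
  change (Cmod (f (z + RtoC (h - a) * e) - f z - (z + RtoC (h - a) * e - z) * l)%C
    <= eps * Cmod (z + RtoC (h - a) * e - z)%C) in hd.
  change (Rabs (L (f (z + RtoC (h - a) * e)%C) - L (f (z + RtoC (a - a) * e)%C)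
     - (h - a) * L (e * l)%C) <= eps * Rabs (h - a)).
  rewrite E0, <- Lscal, <- !Lsub.
  replace (z + RtoC (h - a) * e - z)%C with (RtoC (h - a) * e)%C in hd by ring.
  rewrite Cmod_mult, Cmod_R, he, Rmult_1_r in hd.
  eapply Rle_trans; [apply Lb|].
  now rewrite Cmult_assoc.
Qed.

Lemma holomorphic_is_cpd D f i u v :
  holomorphic D f -> D (u, v) ->
  is_cpd i (fun s t => f (s, t)) u v (direction i * C_derive f (u, v))%C.
Proof.
  intros hf h.
  assert (hd : is_derive f (u, v) (C_derive f (u, v)))
    by (apply C_derive_correct; [exact (RtoC 0)|now apply hf]).
  assert (hre : forall w, Rabs (Re w) <= Cmod w)
    by (intro; eapply Rle_trans; [apply Rmax_l|apply Rmax_Cmod]).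
  assert (him : forall w, Rabs (Im w) <= Cmod w)
    by (intro; eapply Rle_trans; [apply Rmax_r|apply Rmax_Cmod]).
  assert (h1 : Cmod (direction i) = 1).
  { transitivity (sqrt 1); [unfold Cmod; f_equal; destruct i; simpl; ring|apply sqrt_1]. }
  assert (k1 : forall (k : R) w, Re (RtoC k * w)%C = k * Re w)
    by (intros; unfold Re; simpl; ring).
  assert (k2 : forall (k : R) w, Im (RtoC k * w)%C = k * Im w)
    by (intros; unfold Im; simpl; ring).
  assert (m1 : forall w w', Re (w - w')%C = Re w - Re w') by reflexivity.
  assert (m2 : forall w w', Im (w - w')%C = Im w - Im w') by reflexivity.
  set (a := match i with cu => u | cv => v end).
  pose proof (is_derive_along_line f Re a _ _ _ m1 k1 hre h1 hd) as H1.
  pose proof (is_derive_along_line f Im a _ _ _ m2 k2 him h1 hd) as H2.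
  destruct i; split; (eapply is_derive_ext; [|first [exact H1|exact H2]]);
    intro t; cbv beta; f_equal; f_equal; unfold a;
    apply injective_projections; simpl; ring.
Qed.

(** * Algebra of the product *)

Lemma dot_comm a b : dot a b = dot b a.
Proof. unfold dot; ring. Qed.
Lemma dot_add_l a b c : dot (vadd a b) c = dot a c + dot b c.
Proof. unfold dot; simpl; ring. Qed.
Lemma dot_add_r a b c : dot c (vadd a b) = dot c a + dot c b.
Proof. unfold dot; simpl; ring. Qed.
Lemma dot_scal_l k a b : dot (vscal k a) b = k * dot a b.
Proof. unfold dot; simpl; ring. Qed.
Lemma dot_scal_r k a b : dot a (vscal k b) = k * dot a b.
Proof. unfold dot; simpl; ring. Qed.

(** The product of two determinants is minus the determinant of the 4 x 4 matrix of
    the products of a, b, m, n with a, b, c, d, because the form has determinant -1.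
    That matrix is block triangular, since m and n are orthogonal to a and b. *)
Lemma det4_mul_gram (a b m n c d : V4) :
  dot a a = dot b b -> dot a b = 0 ->
  dot m a = 0 -> dot m b = 0 -> dot n a = 0 -> dot n b = 0 ->
  det4 a b m n * det4 a b c d =
  - dot a a ^ 2 * (dot m c * dot n d - dot m d * dot n c).
Proof.
  intros h1 h2 h3 h4 h5 h6.
  transitivity (- (
    (dot a a * dot b b - dot a b * dot a b) * (dot m c * dot n d - dot m d * dot n c)
    - (dot a a * dot m b - dot m a * dot a b) * (dot b c * dot n d - dot b d * dot n c)
    + (dot a a * dot n b - dot n a * dot a b) * (dot b c * dot m d - dot b d * dot m c)
    + (dot a b * dot m b - dot m a * dot b b) * (dot a c * dot n d - dot a d * dot n c)
    - (dot a b * dot n b - dot n a * dot b b) * (dot a c * dot m d - dot a d * dot m c)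
    + (dot m a * dot n b - dot n a * dot m b) * (dot a c * dot b d - dot a d * dot b c))).
  (* The determinant of products, by Laplace expansion along its first two columns. *)
  - clear. destruct a, b, c, d, m, n. unfold det4, det3, dot. simpl. ring.
  - rewrite h2, h3, h4, h5, h6, <- h1. ring.
Qed.

(** A pair (a, b) of real vectors stands for the complex vector a - i b, as
    (x_u, x_v) does for Phi; the two vectors below form the pair of z (a - i b). *)
Definition turn_u (z : C) (a b : V4) : V4 := vadd (vscal (Re z) a) (vscal (Im z) b).
Definition turn_v (z : C) (a b : V4) : V4 := vadd (vscal (Re z) b) (vscal (- Im z) a).

(** Up to the factor -4, [det4] is here the complex determinant of Phi, conj Phi,
    Phi', conj Phi'. Adding a multiple of Phi to Phi' does not change it, and
    each of its four vectors contributes a factor of modulus |q|. *)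
Lemma det4_turn (q r : C) (a b a' b' : V4) :
  let xu := turn_u q a b in
  let xv := turn_v q a b in
  det4 xu xv (vadd (turn_u q a' b') (turn_u r xu xv)) (vadd (turn_v q a' b') (turn_v r xu xv))
  = (Re q ^ 2 + Im q ^ 2) ^ 2 * det4 a b a' b'.
Proof.
  destruct q as [q1 q2], r as [r1 r2], a as [a1 a2 a3 a4], b as [b1 b2 b3 b4],
    a' as [d1 d2 d3 d4], b' as [e1 e2 e3 e4].
  unfold det4, det3, turn_u, turn_v. simpl. ring.
Qed.

(** For Phi = xu - i xv and Phi' = yu - i yv with Phi . Phi = Phi . Phi' = 0 one has
    Phi . conj Phi = 2 xu^2, Phi' . conj Phi' = yu^2 + yv^2 and
    Phi' . conj Phi = 2 (xu . yu - i xu . yv), so that this is half of the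
    Hermitian Gram determinant of Phi and Phi'. *)
Definition half_gram (xu yu yv : V4) : R :=
  dot xu xu * (dot yu yu + dot yv yv) - 2 * (dot xu yu ^ 2 + dot xu yv ^ 2).

(** A Gram determinant does not change when a multiple of the first vector is added
    to the second one. The hypotheses say that the complex vector a - i b is isotropic
    and orthogonal to a' - i b'; then [half_gram] is half of that determinant. *)
Lemma half_gram_turn (q r : C) (a b a' b' : V4) :
  dot a a = dot b b -> dot a b = 0 -> dot a a' = dot b b' -> dot a b' = - dot b a' ->
  let xu := turn_u q a b in
  let xv := turn_v q a b in
  half_gram xu (vadd (turn_u q a' b') (turn_u r xu xv)) (vadd (turn_v q a' b') (turn_v r xu xv))
  = (Re q ^ 2 + Im q ^ 2) ^ 2 * half_gram a a' b'.
Proof.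
  intros h1 h2 h3 h4 xu xv.
  unfold half_gram, xu, xv, turn_u, turn_v.
  rewrite ?dot_add_l, ?dot_add_r, ?dot_scal_l, ?dot_scal_r,
    ?dot_add_l, ?dot_add_r, ?dot_scal_l, ?dot_scal_r.
  rewrite (dot_comm b a), (dot_comm b' a'), (dot_comm b' a), (dot_comm b' b),
    (dot_comm a' a), (dot_comm a' b).
  rewrite h2, <- h1, h4, <- h3. ring.
Qed.

Lemma dot_turn q a b :
  dot a a = dot b b -> dot a b = 0 ->
  dot (turn_u q a b) (turn_u q a b) = Cmod q ^ 2 * dot a a /\
  dot (turn_v q a b) (turn_v q a b) = Cmod q ^ 2 * dot a a /\
  dot (turn_u q a b) (turn_v q a b) = 0.
Proof.
  intros h1 h2. rewrite Cmod2_alt. unfold turn_u, turn_v.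
  rewrite !dot_add_l, !dot_add_r, !dot_scal_l, !dot_scal_r.
  rewrite (dot_comm b a), <- h1, h2. repeat split; ring.
Qed.

(** * The numerator of the Weierstrass representation *)

(** The numerator psi = s Phi as a pair of real vectors; [dnum_u] and [dnum_v] give
    its derivative when a and b are the derivatives of g1 and g2. *)
Definition num_u (g1 g2 : C) : V4 :=
  mkV4 (Re (Ci / 2 * (g1 * g2 + 1))) (Re (1 / 2 * (g1 * g2 - 1)))
    (Re (1 / 2 * (g1 + g2))) (Re (1 / 2 * (g1 - g2))).
Definition num_v (g1 g2 : C) : V4 :=
  mkV4 (- Im (Ci / 2 * (g1 * g2 + 1))) (- Im (1 / 2 * (g1 * g2 - 1)))
    (- Im (1 / 2 * (g1 + g2))) (- Im (1 / 2 * (g1 - g2))).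
Definition dnum_u (g1 g2 a b : C) : V4 :=
  mkV4 (Re (Ci / 2 * (a * g2 + g1 * b))) (Re (1 / 2 * (a * g2 + g1 * b)))
    (Re (1 / 2 * (a + b))) (Re (1 / 2 * (a - b))).
Definition dnum_v (g1 g2 a b : C) : V4 :=
  mkV4 (- Im (Ci / 2 * (a * g2 + g1 * b))) (- Im (1 / 2 * (a * g2 + g1 * b)))
    (- Im (1 / 2 * (a + b))) (- Im (1 / 2 * (a - b))).

Lemma num_identities (g1 g2 a b : C) :
  let p := (1 + g1 * Cconj g2)%C in
  let w := (a * Cconj b * (Cconj p * Cconj p))%C in
  let xu := num_u g1 g2 in
  let xv := num_v g1 g2 in
  let yu := dnum_u g1 g2 a b in
  let yv := dnum_v g1 g2 a b in
  dot xu xu = (Re p ^ 2 + Im p ^ 2) / 4 /\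
  dot xu xu = dot xv xv /\ dot xu xv = 0 /\
  dot xu yu = dot xv yv /\ dot xu yv = - dot xv yu /\
  half_gram xu yu yv = Re w / 4 /\ det4 xu xv yu yv = Im w / 8.
Proof.
  destruct g1 as [p1 p2], g2 as [q1 q2], a as [a1 a2], b as [b1 b2].
  cbv zeta. unfold half_gram, det4, det3, dot, num_u, num_v, dnum_u, dnum_v, Re, Im. simpl.
  repeat split; field.
Qed.

(** * The Gauss curvature *)

(** The formula K = - (log E)_laplace / (2E), from the Christoffel symbols: their
    quadratic terms cancel in isothermal coordinates. *)
Lemma gauss_curvature_isothermal D (g : coord -> coord -> R -> R -> R)
    (E Eu Ev : R -> R -> R) (Euu Evv u v : R) :
  open (T := C_UniformSpace) D ->
  (forall s t, D (s, t) ->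
     g cu cu s t = E s t /\ g cv cv s t = E s t /\ g cu cv s t = 0 /\ g cv cu s t = 0) ->
  (forall s t, D (s, t) -> E s t <> 0) ->
  (forall s t, D (s, t) -> is_pd cu E s t (Eu s t) /\ is_pd cv E s t (Ev s t)) ->
  D (u, v) -> is_pd cu Eu u v Euu -> is_pd cv Ev u v Evv ->
  gauss_curvature g u v =
    - (Euu + Evv) / (2 * E u v ^ 2) + (Eu u v ^ 2 + Ev u v ^ 2) / (2 * E u v ^ 3).
Proof.
  intros hD hg hE hd h huu hvv.
  assert (guu : forall i s t, D (s, t) -> pd i (g cu cu) s t = match i with cu => Eu s t | cv => Ev s t end).
  { intros i s t hst. rewrite (pd_ext D i _ E) by (trivial; apply hg).
    destruct (hd s t hst). destruct i; now apply is_pd_unique. }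
  assert (gvv : forall i s t, D (s, t) -> pd i (g cv cv) s t = match i with cu => Eu s t | cv => Ev s t end).
  { intros i s t hst. rewrite (pd_ext D i _ E) by (trivial; apply hg).
    destruct (hd s t hst). destruct i; now apply is_pd_unique. }
  assert (guv : forall i s t, D (s, t) -> pd i (g cu cv) s t = 0).
  { intros i s t hst. rewrite (pd_ext D i _ (fun _ _ => 0)) by (trivial; apply hg).
    apply is_pd_unique, is_pd_const. }
  assert (gvu : forall i s t, D (s, t) -> pd i (g cv cu) s t = 0).
  { intros i s t hst. rewrite (pd_ext D i _ (fun _ _ => 0)) by (trivial; apply hg).
    apply is_pd_unique, is_pd_const. }
  assert (chr : forall k i j s t, D (s, t) ->
    christoffel g k i j s t =
    match k, i, j with
    | cu, cu, cu => Eu s t / (2 * E s t)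
    | cu, cv, cv => - Eu s t / (2 * E s t)
    | cu, _, _ => Ev s t / (2 * E s t)
    | cv, cv, cv => Ev s t / (2 * E s t)
    | cv, cu, cu => - Ev s t / (2 * E s t)
    | cv, _, _ => Eu s t / (2 * E s t)
    end).
  { intros k i j s t hst. unfold christoffel, sum2, ginv, gdet.
    destruct (hg s t hst) as (e1 & e2 & e3 & e4). pose proof (hE s t hst) as e5.
    destruct k, i, j; rewrite ?guu, ?gvv, ?guv, ?gvu, e1, e2, e3, e4 by trivial;
      field; exact e5. }
  destruct (hd u v h) as [hu hv]. pose proof (hE u v h) as hE0.
  assert (h2E : 2 * E u v <> 0) by lra.
  assert (d1 : pd cu (christoffel g cu cv cv) u v =
     ((-1 * Euu) * (2 * E u v) - (-1 * Eu u v) * (2 * Eu u v)) / (2 * E u v) ^ 2).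
  { rewrite (pd_ext D cu _ (fun s t => (-1 * Eu s t) / (2 * E s t)));
      trivial.
    2: { intros s t hst. rewrite chr by trivial. simpl. field. now apply hE. }
    apply is_pd_unique.
    eapply (is_pd_div cu (fun s t => -1 * Eu s t) (fun s t => 2 * E s t)); trivial.
    - replace (-1 * Euu) with (0 * Eu u v + -1 * Euu) by ring.
      apply (is_pd_mult cu (fun _ _ => -1) Eu); trivial. apply is_pd_const.
    - replace (2 * Eu u v) with (0 * E u v + 2 * Eu u v) by ring.
      apply (is_pd_mult cu (fun _ _ => 2) E); trivial. apply is_pd_const. }
  assert (d2 : pd cv (christoffel g cu cu cv) u v =
     (Evv * (2 * E u v) - Ev u v * (2 * Ev u v)) / (2 * E u v) ^ 2).
  { rewrite (pd_ext D cv _ (fun s t => Ev s t / (2 * E s t))); trivial.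
    2: { intros s t hst. now rewrite chr by trivial. }
    apply is_pd_unique.
    eapply (is_pd_div cv Ev (fun s t => 2 * E s t)); trivial.
    replace (2 * Ev u v) with (0 * E u v + 2 * Ev u v) by ring.
    apply (is_pd_mult cv (fun _ _ => 2) E); trivial. apply is_pd_const. }
  destruct (hg u v h) as (e1 & e2 & e3 & e4).
  unfold gauss_curvature, sum2 at 1, gdet. rewrite e1, e2, e3, e4.
  unfold riemann_uvv at 1. rewrite d1, d2. unfold sum2. rewrite !chr by trivial.
  field. exact hE0.
Qed.

Definition isothermal_factor (x : R -> R -> V4) (u v E : R) : Prop :=
  metric x cu cu u v = E /\ metric x cv cv u v = E /\
  metric x cu cv u v = 0 /\ metric x cv cu u v = 0 /\ 0 < E.

(** E_u = 2 x_u . x_uu and E_v = 2 x_u . x_uv. In the Laplacian of E = x_u^2 the third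
    derivatives of x drop out because x_u is harmonic, leaving 2 (x_uu^2 + x_uv^2). *)
Lemma gauss_curvature_harmonic D x u v :
  open (T := C_UniformSpace) D -> vsmooth D x ->
  (forall s t, D (s, t) -> isothermal_factor x s t (metric x cu cu s t)) ->
  (forall s t, D (s, t) -> vpd cv (vpd cv x) s t = vscal (-1) (vpd cu (vpd cu x) s t)) ->
  D (u, v) ->
  gauss_curvature (metric x) u v =
  - half_gram (vpd cu x u v) (vpd cu (vpd cu x) u v) (vpd cv (vpd cu x) u v)
    / metric x cu cu u v ^ 3.
Proof.
  intros hD hx hiso hh h.
  assert (sm := fun i => vsmooth_vpd D x i hx).
  assert (sm2 := fun i j => vsmooth_vpd D _ j (sm i)).
  assert (dd : forall f g i s t, vsmooth D f -> vsmooth D g -> D (s, t) ->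
     is_pd i (fun s t => dot (f s t) (g s t)) s t
       (dot (vpd i f s t) (g s t) + dot (f s t) (vpd i g s t))).
  { intros f g i s t hf hg hst. apply is_pd_dot; now apply (vsmooth_is_vpd D). }
  set (y := vpd cu x).
  assert (hlap : vpd cv (vpd cv y) u v = vscal (-1) (vpd cu (vpd cu y) u v)).
  { rewrite (vpd_ext D cv _ (vpd cu (vpd cv x)) u v hD h)
      by (intros a b hab; symmetry; exact (vpd_comm D x a b hD hab hx)).
    rewrite <- (vpd_comm D _ u v hD h (sm cv)).
    rewrite (vpd_ext D cu _ (fun s t => vscal (-1) (vpd cu y s t)) u v hD h) by exact hh.
    erewrite is_vpd_unique.
    2:{ apply (is_vpd_scal cu (fun _ _ => -1)); [apply is_pd_const|].
        exact (vsmooth_is_vpd D (vpd cu y) cu u v (sm2 cu cu) h). }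
    unfold vadd, vscal. f_equal; simpl; ring. }
  pose proof (hiso u v h) as (_ & _ & _ & _ & hE).
  rewrite (gauss_curvature_isothermal D _ (metric x cu cu)
    (fun s t => dot (vpd cu y s t) (y s t) + dot (y s t) (vpd cu y s t))
    (fun s t => dot (vpd cv y s t) (y s t) + dot (y s t) (vpd cv y s t))
    (dot (vpd cu (vpd cu y) u v) (y u v) + dot (vpd cu y u v) (vpd cu y u v)
      + (dot (vpd cu y u v) (vpd cu y u v) + dot (y u v) (vpd cu (vpd cu y) u v)))
    (dot (vpd cv (vpd cv y) u v) (y u v) + dot (vpd cv y u v) (vpd cv y u v)
      + (dot (vpd cv y u v) (vpd cv y u v) + dot (y u v) (vpd cv (vpd cv y) u v))) u v);
    trivial.
  - rewrite hlap. unfold half_gram, metric in *. fold y in hE |- *.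
    set (E := dot (y u v) (y u v)) in *.
    rewrite !dot_scal_l, !dot_scal_r.
    rewrite (dot_comm (vpd cu y u v) (y u v)), (dot_comm (vpd cv y u v) (y u v)).
    field. lra.
  - intros s t hst. destruct (hiso s t hst) as (e1 & e2 & e3 & e4 & _). tauto.
  - intros s t hst. destruct (hiso s t hst) as (_ & _ & _ & _ & e). lra.
  - intros s t hst. split; apply (dd y y); trivial; apply sm.
  - apply is_pd_plus; apply (dd _ _ cu u v); try exact h; apply sm2 || apply sm.
  - apply is_pd_plus; apply (dd _ _ cv u v); try exact h; apply sm2 || apply sm.
Qed.

(** * The curvature of the normal connection *)

Lemma normal_dx x u v n i : is_normal x u v n -> dot n (vpd i x u v) = 0.
Proof.
  intro h. apply h. exists (cbasis i). unfold dx, vsum2, vadd, vscal, cbasis.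
  destruct i; cbn [c1 c2 c3 c4 vpd]; unfold vpd; f_equal; ring.
Qed.

Lemma normal_part_isothermal x u v E w :
  isothermal_factor x u v E ->
  normal_part x u v w =
  vadd w (vadd (vscal (- dot w (vpd cu x u v) / E) (vpd cu x u v))
               (vscal (- dot w (vpd cv x u v) / E) (vpd cv x u v))).
Proof.
  intros (h1 & h2 & h3 & h4 & h5).
  unfold normal_part, vsum2, ginv, gdet. rewrite h1, h2, h3, h4.
  generalize (vpd cu x u v) (vpd cv x u v). intros a b.
  generalize (dot w a) (dot w b). intros.
  destruct w, a, b. unfold vsub, vadd, vscal. simpl. f_equal; field; lra.
Qed.

(** Differentiate n . x_j = 0. *)
Lemma normal_weingarten D U x n i j s t :
  vsmooth D x -> open (T := C_UniformSpace) U -> (forall z, U z -> D z) ->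
  vsmooth U n -> (forall a b, U (a, b) -> is_normal x a b (n a b)) ->
  U (s, t) ->
  dot (vpd i n s t) (vpd j x s t) = - dot (n s t) (vpd i (vpd j x) s t).
Proof.
  intros hx hU hUD hn hnn h.
  pose proof (is_pd_dot i n (vpd j x) s t _ _ (vsmooth_is_vpd U n i s t hn h)
     (vsmooth_is_vpd D (vpd j x) i s t (vsmooth_vpd D x j hx) (hUD _ h))) as h1.
  apply is_pd_unique in h1.
  rewrite (pd_ext U i _ (fun _ _ => 0)) in h1; trivial.
  - rewrite (is_pd_unique _ _ _ _ _ (is_pd_const i 0 s t)) in h1. lra.
  - intros a b hab. now apply normal_dx, hnn.
Qed.

Lemma nabla_normal_coord D U x n i k X s t :
  vsmooth D x -> open (T := C_UniformSpace) U -> (forall z, U z -> D z) ->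
  vsmooth U n -> (forall a b, U (a, b) -> is_normal x a b (n a b)) ->
  isothermal_factor x s t (metric x cu cu s t) ->
  (forall j, X j = k * cbasis i j) -> U (s, t) ->
  nabla_normal x X n s t =
  vadd (vscal k (vpd i n s t))
    (vadd (vscal (k * dot (n s t) (vpd i (vpd cu x) s t) / metric x cu cu s t) (vpd cu x s t))
          (vscal (k * dot (n s t) (vpd i (vpd cv x) s t) / metric x cu cu s t) (vpd cv x s t))).
Proof.
  intros hx hU hUD hn hnn hiso hX h. unfold nabla_normal.
  replace (nabla X n s t) with (vscal k (vpd i n s t)).
  2:{ unfold nabla, vsum2. rewrite !hX. unfold cbasis.
      destruct i; generalize (vpd cu n s t) (vpd cv n s t);
      intros a b; destruct a, b; unfold vadd, vscal; simpl; f_equal; ring. }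
  rewrite (normal_part_isothermal _ _ _ _ _ hiso), !dot_scal_l.
  rewrite !(normal_weingarten D U x n) by trivial.
  f_equal. f_equal; f_equal; unfold Rdiv; ring.
Qed.

(** The derivatives of the coefficients of x_u and x_v in [nabla_normal_coord] are not
    computed: they multiply tangent vectors, which are orthogonal to m. *)
Lemma dot_pd_nabla_normal D U x n m i j k X u v :
  open (T := C_UniformSpace) D -> vsmooth D x ->
  (forall s t, D (s, t) -> isothermal_factor x s t (metric x cu cu s t)) ->
  open (T := C_UniformSpace) U -> (forall z, U z -> D z) ->
  vsmooth U n -> (forall s t, U (s, t) -> is_normal x s t (n s t)) ->
  (forall j, X j = k * cbasis i j) -> U (u, v) -> is_normal x u v m ->
  dot m (vpd j (nabla_normal x X n) u v) =
  k * dot m (vpd j (vpd i n) u v)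
  + k / metric x cu cu u v *
    (dot (n u v) (vpd i (vpd cu x) u v) * dot m (vpd j (vpd cu x) u v)
     + dot (n u v) (vpd i (vpd cv x) u v) * dot m (vpd j (vpd cv x) u v)).
Proof.
  intros hD hx hiso hU hUD hn hnn hX h hm.
  assert (hc : forall l, exists a, is_pd j
     (fun s t => k * dot (n s t) (vpd i (vpd l x) s t) / metric x cu cu s t) u v a).
  { intro l. pose proof (hUD _ h) as hDuv.
    destruct (hiso u v hDuv) as (_ & _ & _ & _ & hE).
    eexists. apply (is_pd_div j (fun s t => k * dot (n s t) (vpd i (vpd l x) s t))).
    - apply (is_pd_mult j (fun _ _ => k)); [apply is_pd_const|].
      apply is_pd_dot.
      + now apply (vsmooth_is_vpd U).
      + apply (vsmooth_is_vpd D); trivial. now do 2 apply vsmooth_vpd.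
    - unfold metric. apply is_pd_dot; apply (vsmooth_is_vpd D); trivial; now apply vsmooth_vpd.
    - lra. }
  destruct (hc cu) as [a ha], (hc cv) as [b hb].
  rewrite (vpd_ext U j _ _ u v hU h
    (fun s t hst => nabla_normal_coord D U x n i k X s t hx hU hUD hn hnn
       (hiso s t (hUD _ hst)) hX hst)).
  erewrite is_vpd_unique.
  2:{ apply is_vpd_add; [|apply is_vpd_add].
      - apply (is_vpd_scal j (fun _ _ => k)); [apply is_pd_const|].
        apply (vsmooth_is_vpd U); trivial. now apply vsmooth_vpd.
      - apply (is_vpd_scal j); [exact ha|].
        apply (vsmooth_is_vpd D); auto. now apply vsmooth_vpd.
      - apply (is_vpd_scal j); [exact hb|].
        apply (vsmooth_is_vpd D); auto. now apply vsmooth_vpd. }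
  cbv beta. rewrite !dot_add_r, !dot_scal_r, !(normal_dx x u v m) by trivial.
  unfold Rdiv. ring.
Qed.

(** This is the Ricci equation. In the commutator of the two normal derivatives of n2
    the mixed second derivatives of n2 cancel; x_vv = - x_uu makes the four
    remaining products equal in pairs. *)
Lemma normal_curvature_isothermal D U x n1 n2 u v :
  open (T := C_UniformSpace) D -> vsmooth D x ->
  (forall s t, D (s, t) -> isothermal_factor x s t (metric x cu cu s t)) ->
  open (T := C_UniformSpace) U -> (forall z, U z -> D z) -> U (u, v) ->
  oriented_normal_frame x U n1 n2 ->
  let xuu := vpd cu (vpd cu x) u v in
  let xuv := vpd cv (vpd cu x) u v in
  vpd cv (vpd cv x) u v = vscal (-1) xuu ->
  normal_curvature x n1 n2 u v =
  2 / metric x cu cu u v ^ 2 *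
    (dot (n1 u v) xuu * dot (n2 u v) xuv - dot (n1 u v) xuv * dot (n2 u v) xuu).
Proof.
  intros hD hx hiso hU hUD h (hn1 & hn2 & hfr) xuu xuv hharm.
  pose proof (hUD _ h) as hDuv.
  destruct (hfr u v h) as (hm & _ & _ & _ & _ & _).
  destruct (hiso u v hDuv) as (_ & _ & _ & _ & hE).
  assert (hnn : forall s t, U (s, t) -> is_normal x s t (n2 s t))
    by (intros s t hst; now destruct (hfr s t hst)).
  set (E := metric x cu cu u v) in *.
  set (k := / sqrt E).
  assert (hk : k * k = / E).
  { unfold k. rewrite <- Rinv_mult, sqrt_sqrt; lra. }
  assert (hX1 : forall j, X1 x u v j = k * cbasis cu j)
    by (intros []; unfold X1, cbasis, coefE; fold E k; ring).
  assert (hX2 : forall j, X2 x u v j = k * cbasis cv j)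
    by (intros []; unfold X2, cbasis, coefE; fold E k; ring).
  assert (hproj : forall w, dot (normal_part x u v w) (n1 u v) = dot (n1 u v) w).
  { intro w. rewrite (normal_part_isothermal _ _ _ _ _ (hiso u v hDuv)).
    rewrite !dot_add_l, !dot_scal_l.
    rewrite (dot_comm _ (n1 u v)), (dot_comm (vpd cu x u v)), (dot_comm (vpd cv x u v)).
    rewrite !(normal_dx x u v (n1 u v) _ hm). ring. }
  unfold normal_curvature, RN, vsub.
  rewrite dot_add_l, dot_scal_l. unfold nabla_normal at 1 3. rewrite !hproj.
  unfold nabla, vsum2. rewrite !hX1, !hX2. unfold cbasis.
  rewrite !dot_add_r, !dot_scal_r.
  rewrite !(dot_pd_nabla_normal D U x n2 (n1 u v) cv _ k (X2 x u v)) by trivial.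
  rewrite !(dot_pd_nabla_normal D U x n2 (n1 u v) cu _ k (X1 x u v)) by trivial.
  rewrite (vpd_comm U n2) by trivial.
  rewrite (vpd_comm D x) by trivial. rewrite hharm. fold xuu xuv E.
  rewrite !dot_scal_r.
  transitivity (k * k * (2 / E *
    (dot (n1 u v) xuu * dot (n2 u v) xuv - dot (n1 u v) xuv * dot (n2 u v) xuu))).
  - unfold Rdiv. ring.
  - rewrite hk. field. lra.
Qed.

(** Apply [det4_mul_gram] twice: with (c, d) = (n1, n2) it gives
    det(x_u, x_v, n1, n2)^2 = E^2, hence the determinant is E by the orientation of
    the frame, and with (c, d) = (x_uu, x_uv) it evaluates the products in
    [normal_curvature_isothermal]. *)
Lemma normal_curvature_det D U x n1 n2 u v :
  open (T := C_UniformSpace) D -> vsmooth D x ->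
  (forall s t, D (s, t) -> isothermal_factor x s t (metric x cu cu s t)) ->
  open (T := C_UniformSpace) U -> (forall z, U z -> D z) -> U (u, v) ->
  oriented_normal_frame x U n1 n2 ->
  let xuu := vpd cu (vpd cu x) u v in
  let xuv := vpd cv (vpd cu x) u v in
  vpd cv (vpd cv x) u v = vscal (-1) xuu ->
  normal_curvature x n1 n2 u v =
  -2 * det4 (vpd cu x u v) (vpd cv x u v) xuu xuv / metric x cu cu u v ^ 3.
Proof.
  intros hD hx hiso hU hUD h hfr xuu xuv hharm.
  rewrite (normal_curvature_isothermal D U) by trivial. fold xuu xuv.
  pose proof (hiso u v (hUD _ h)) as (h1 & h2 & h3 & h4 & hE).
  destruct hfr as (_ & _ & hfr). destruct (hfr u v h) as (k1 & k2 & k3 & k4 & k5 & k6).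
  set (E := metric x cu cu u v) in *.
  set (k := / sqrt E).
  assert (hk : k * k = / E).
  { unfold k. rewrite <- Rinv_mult, sqrt_sqrt; lra. }
  replace (dx x u v (X1 x u v)) with (vscal k (vpd cu x u v)) in k6.
  2:{ unfold dx, vsum2, X1, coefE. fold E k. generalize (vpd cu x u v) (vpd cv x u v).
      intros a b; destruct a, b; unfold vadd, vscal; simpl; f_equal; ring. }
  replace (dx x u v (X2 x u v)) with (vscal k (vpd cv x u v)) in k6.
  2:{ unfold dx, vsum2, X2, coefE. fold E k. generalize (vpd cu x u v) (vpd cv x u v).
      intros a b; destruct a, b; unfold vadd, vscal; simpl; f_equal; ring. }
  replace (det4 (vscal k (vpd cu x u v)) (vscal k (vpd cv x u v)) (n1 u v) (n2 u v))
    with (k * k * det4 (vpd cu x u v) (vpd cv x u v) (n1 u v) (n2 u v)) in k6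
    by (unfold det4, det3, vscal; simpl; ring).
  set (xu := vpd cu x u v) in *. set (xv := vpd cv x u v) in *.
  assert (hn1 : forall i, dot (n1 u v) (vpd i x u v) = 0) by (intro; now apply normal_dx).
  assert (hn2 : forall i, dot (n2 u v) (vpd i x u v) = 0) by (intro; now apply normal_dx).
  change (dot xu xu = E) in h1. change (dot xv xv = E) in h2. change (dot xu xv = 0) in h3.
  pose proof (fun c d => det4_mul_gram xu xv (n1 u v) (n2 u v) c d (eq_trans h1 (eq_sym h2)) h3
    (hn1 cu) (hn1 cv) (hn2 cu) (hn2 cv)) as hdet.
  assert (hvol : det4 xu xv (n1 u v) (n2 u v) = E).
  { pose proof (hdet (n1 u v) (n2 u v)) as e.
    rewrite (dot_comm (n2 u v) (n1 u v)), k3, k4, k5, h1 in e. rewrite hk in k6.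
    assert (0 < det4 xu xv (n1 u v) (n2 u v)).
    { apply Rmult_lt_reg_l with (/ E). now apply Rinv_0_lt_compat. now rewrite Rmult_0_r. }
    nra. }
  specialize (hdet xuu xuv). rewrite hvol, h1 in hdet.
  assert (e : dot (n1 u v) xuu * dot (n2 u v) xuv - dot (n1 u v) xuv * dot (n2 u v) xuu
     = - det4 xu xv xuu xuv / E).
  { apply Rmult_eq_reg_l with (- E ^ 2); [rewrite <- hdet; field; lra|].
    assert (0 < E ^ 2) by (apply pow_lt; lra). lra. }
  rewrite e. field. lra.
Qed.

(** * Second derivatives of the surface *)

(** X stands for a coordinate of x. Both partial derivatives of s Phi = psi are
    computed by the product rule; dividing by s, they show that the derivative of
    Phi in the direction v is i times that in the direction u. *)
Lemma holomorphic_quotient_pd D (X : R -> R -> R) (S psi : R -> R -> C) (dS dpsi : C) u v :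
  open (T := C_UniformSpace) D -> smooth D X -> D (u, v) ->
  (forall s t, D (s, t) ->
     ((RtoC (pd cu X s t) - Ci * RtoC (pd cv X s t)) * S s t = psi s t)%C) ->
  (forall i, is_cpd i S u v (direction i * dS)%C) ->
  (forall i, is_cpd i psi u v (direction i * dpsi)%C) ->
  S u v <> RtoC 0 ->
  ((RtoC (pd cu (pd cu X) u v) - Ci * RtoC (pd cv (pd cu X) u v)) * S u v
    = dpsi - dS * (RtoC (pd cu X u v) - Ci * RtoC (pd cv X u v)))%C /\
  pd cv (pd cv X) u v = - pd cu (pd cu X) u v.
Proof.
  intros hD hX h hrel hS hpsi hne.
  assert (hphi : forall i, is_cpd i (fun s t => (RtoC (pd cu X s t) - Ci * RtoC (pd cv X s t))%C) u v
     (RtoC (pd i (pd cu X) u v) - Ci * RtoC (pd i (pd cv X) u v))%C).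
  { intro i.
    pose proof (smooth_is_pd D _ i u v (smooth_pd D X cu hX) h) as h1.
    pose proof (smooth_is_pd D _ i u v (smooth_pd D X cv hX) h) as h2.
    split.
    - apply (is_pd_ext D i (pd cu X)); trivial.
      + intros s t _. unfold Re. simpl. ring.
      + replace (Re _) with (pd i (pd cu X) u v) by (unfold Re; simpl; ring). exact h1.
    - apply (is_pd_ext D i (fun s t => 0 - pd cv X s t)); trivial.
      + intros s t _. unfold Im. simpl. ring.
      + replace (Im _) with (0 - pd i (pd cv X) u v) by (unfold Im; simpl; ring).
        apply is_pd_minus; [apply is_pd_const|exact h2]. }
  assert (heq := fun i => is_cpd_unique i _ u v _ _
    (is_cpd_ext D i _ psi u v _ hD h hrel (is_cpd_mult i _ _ _ _ _ _ (hphi i) (hS i)))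
    (hpsi i)).
  pose proof (heq cu) as hu. pose proof (heq cv) as hv. cbv beta in hu, hv. simpl direction in hu, hv.
  rewrite (smooth_pd_comm D X u v hD h hX) in hu.
  set (phi := (RtoC (pd cu X u v) - Ci * RtoC (pd cv X u v))%C) in *.
  set (yu := (RtoC (pd cu (pd cu X) u v) - Ci * RtoC (pd cv (pd cu X) u v))%C) in *.
  set (yv := (RtoC (pd cv (pd cu X) u v) - Ci * RtoC (pd cv (pd cv X) u v))%C) in *.
  assert (hu' : (yu * S u v = dpsi - dS * phi)%C).
  { replace (yu * S u v)%C with (yu * S u v + phi * (1 * dS) - dS * phi)%C by ring.
    rewrite hu. ring. }
  split; [exact hu'|].
  assert (hv' : (yv * S u v = Ci * (yu * S u v))%C).
  { replace (yv * S u v)%C with (yv * S u v + phi * (Ci * dS) - Ci * dS * phi)%C by ring.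
    rewrite hv, hu'. ring. }
  assert (e : yv = (Ci * yu)%C).
  { transitivity (yv * S u v / S u v)%C; [field; exact hne|]. rewrite hv'. field; exact hne. }
  apply (f_equal snd) in e. revert e. unfold yv, yu.
  generalize (pd cu (pd cu X) u v) (pd cv (pd cu X) u v) (pd cv (pd cv X) u v).
  simpl. intros. lra.
Qed.

Lemma turn_of_quotient (a b : R) (q z : C) :
  (RtoC a - Ci * RtoC b = z * q)%C ->
  a = Re q * Re z + Im q * - Im z /\ b = Re q * - Im z + - Im q * Re z.
Proof.
  intro h. pose proof (f_equal fst h) as h1. pose proof (f_equal snd h) as h2.
  destruct q, z. unfold Re, Im. simpl in *. split; lra.
Qed.

(** With q = 1/s and r = - s'/s this reads Phi = q psi and Phi' = q psi' + r Phi;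
    x_vv = - x_uu comes from the Cauchy-Riemann equations for Phi. *)
Lemma weierstrass_derivatives D x g1 g2 s u v :
  open (T := C_UniformSpace) D -> vsmooth D x ->
  holomorphic D g1 -> holomorphic D g2 -> holomorphic D s ->
  (forall z, D z -> s z <> RtoC 0) ->
  (forall a b, D (a, b) -> canonical_weierstrass_at x g1 g2 s a b) ->
  D (u, v) ->
  let t : C := (u, v) in
  let q := (/ s t)%C in
  let r := (- (C_derive s t) * q)%C in
  let A := num_u (g1 t) (g2 t) in
  let B := num_v (g1 t) (g2 t) in
  let A' := dnum_u (g1 t) (g2 t) (C_derive g1 t) (C_derive g2 t) in
  let B' := dnum_v (g1 t) (g2 t) (C_derive g1 t) (C_derive g2 t) in
  let xu := turn_u q A B in
  let xv := turn_v q A B in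
  vpd cu x u v = xu /\ vpd cv x u v = xv /\
  vpd cu (vpd cu x) u v = vadd (turn_u q A' B') (turn_u r xu xv) /\
  vpd cv (vpd cu x) u v = vadd (turn_v q A' B') (turn_v r xu xv) /\
  vpd cv (vpd cv x) u v = vscal (-1) (vpd cu (vpd cu x) u v).
Proof.
  intros hD (hx1 & hx2 & hx3 & hx4) hg1 hg2 hs hs0 hW h t q r A B A' B' xu xv.
  set (a := C_derive g1 t). set (b := C_derive g2 t). set (ds := C_derive s t).
  assert (hq : forall z w : C, (z * s t = w)%C -> z = (w * q)%C).
  { intros z w <-. unfold q. field. now apply hs0. }
  assert (hG1 := fun i => holomorphic_is_cpd D g1 i u v hg1 h).
  assert (hG2 := fun i => holomorphic_is_cpd D g2 i u v hg2 h).
  assert (hS := fun i => holomorphic_is_cpd D s i u v hs h).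
  fold t a in hG1. fold t b in hG2. fold t ds in hS.
  assert (comp : forall (X : R -> R -> R) (psi : R -> R -> C) (dpsi : C),
    smooth D X ->
    (forall c d, D (c, d) ->
      (RtoC (pd cu X c d) - Ci * RtoC (pd cv X c d) = psi c d / s (c, d))%C) ->
    (forall i, is_cpd i psi u v (direction i * dpsi)%C) ->
    let yu := Re q * Re (psi u v) + Im q * - Im (psi u v) in
    let yv := Re q * - Im (psi u v) + - Im q * Re (psi u v) in
    pd cu X u v = yu /\ pd cv X u v = yv /\
    pd cu (pd cu X) u v
      = Re q * Re dpsi + Im q * - Im dpsi + (Re r * yu + Im r * yv) /\
    pd cv (pd cu X) u v
      = Re q * - Im dpsi + - Im q * Re dpsi + (Re r * yv + - Im r * yu) /\
    pd cv (pd cv X) u v = -1 * pd cu (pd cu X) u v).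
  { intros X psi dpsi hX hrel hpsi yu yv.
    destruct (holomorphic_quotient_pd D X (fun c d => s (c, d)) psi ds dpsi u v hD hX h)
      as [h2 h3]; trivial.
    { intros c d hcd. rewrite hrel by trivial. field. now apply hs0. }
    { now apply hs0. }
    pose proof (turn_of_quotient _ _ _ _ (hrel u v h)) as [e1 e2].
    fold t in e1, e2. fold q yu yv in e1, e2.
    cbv beta in h2. fold t in h2. apply hq in h2.
    apply turn_of_quotient in h2. destruct h2 as [e3 e4].
    repeat split; trivial; [rewrite e3|rewrite e4|rewrite h3; ring];
      rewrite e1, e2;
      unfold r; fold ds; clear; unfold Re, Im; simpl; ring. }
  assert (hk : forall i (k : C), is_cpd i (fun _ _ => k) u v (RtoC 0))
    by (intros; apply is_cpd_const).
  assert (hP := fun i => is_cpd_mult i _ _ _ _ _ _ (hG1 i) (hG2 i)).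
  destruct (comp (fun c d => c1 (x c d)) (fun c d => Ci / 2 * (g1 (c, d) * g2 (c, d) + 1))%C
    (Ci / 2 * (a * g2 t + g1 t * b))%C hx1) as (a1 & a2 & a3 & a4 & a5).
  { intros c d hcd. destruct (hW c d hcd) as (w & _). unfold phi in w.
    simpl vpd in w. etransitivity; [exact w|]. unfold Cdiv. ring. }
  { intro i.
    pose proof (is_cpd_mult i _ _ _ _ _ _ (hk i (Ci / 2)%C)
      (is_cpd_plus i _ _ _ _ _ _ (hP i) (hk i (RtoC 1)))) as w.
    replace (direction i * _)%C with
     (RtoC 0 * (g1 t * g2 t + 1) + Ci / 2 * (direction i * a * g2 t + g1 t * (direction i * b) + RtoC 0))%C
     by (unfold Cdiv; ring). exact w. }
  destruct (comp (fun c d => c2 (x c d)) (fun c d => 1 / 2 * (g1 (c, d) * g2 (c, d) - 1))%C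
    (1 / 2 * (a * g2 t + g1 t * b))%C hx2) as (b1 & b2 & b3 & b4 & b5).
  { intros c d hcd. destruct (hW c d hcd) as (_ & w & _). unfold phi in w.
    simpl vpd in w. etransitivity; [exact w|]. unfold Cdiv. ring. }
  { intro i.
    pose proof (is_cpd_mult i _ _ _ _ _ _ (hk i (1 / 2)%C)
      (is_cpd_minus i _ _ _ _ _ _ (hP i) (hk i (RtoC 1)))) as w.
    replace (direction i * _)%C with
     (RtoC 0 * (g1 t * g2 t - 1) + 1 / 2 * (direction i * a * g2 t + g1 t * (direction i * b) - RtoC 0))%C
     by (unfold Cdiv; ring). exact w. }
  destruct (comp (fun c d => c3 (x c d)) (fun c d => 1 / 2 * (g1 (c, d) + g2 (c, d)))%C
    (1 / 2 * (a + b))%C hx3) as (d1 & d2 & d3 & d4 & d5).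
  { intros c d hcd. destruct (hW c d hcd) as (_ & _ & w & _). unfold phi in w.
    simpl vpd in w. etransitivity; [exact w|]. unfold Cdiv. ring. }
  { intro i.
    pose proof (is_cpd_mult i _ _ _ _ _ _ (hk i (1 / 2)%C)
      (is_cpd_plus i _ _ _ _ _ _ (hG1 i) (hG2 i))) as w.
    replace (direction i * _)%C with
     (RtoC 0 * (g1 t + g2 t) + 1 / 2 * (direction i * a + direction i * b))%C
     by (unfold Cdiv; ring). exact w. }
  destruct (comp (fun c d => c4 (x c d)) (fun c d => 1 / 2 * (g1 (c, d) - g2 (c, d)))%C
    (1 / 2 * (a - b))%C hx4) as (f1 & f2 & f3 & f4 & f5).
  { intros c d hcd. destruct (hW c d hcd) as (_ & _ & _ & w). unfold phi in w.
    simpl vpd in w. etransitivity; [exact w|]. unfold Cdiv. ring. }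
  { intro i.
    pose proof (is_cpd_mult i _ _ _ _ _ _ (hk i (1 / 2)%C)
      (is_cpd_minus i _ _ _ _ _ _ (hG1 i) (hG2 i))) as w.
    replace (direction i * _)%C with
     (RtoC 0 * (g1 t - g2 t) + 1 / 2 * (direction i * a - direction i * b))%C
     by (unfold Cdiv; ring). exact w. }
  unfold xu, xv, A, B, A', B'. fold a b.
  assert (V4_eq : forall y z, c1 y = c1 z -> c2 y = c2 z -> c3 y = c3 z -> c4 y = c4 z -> y = z)
    by (intros [] []; simpl; congruence).
  repeat split; apply V4_eq; assumption.
Qed.

(** * The canonical Weierstrass representation *)

Lemma Cmod_inv_sqr (s : C) : s <> RtoC 0 -> Cmod (/ s)%C ^ 2 = / Cmod s ^ 2.
Proof. intro h. rewrite Cmod_inv by exact h. now rewrite pow_inv. Qed.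

Theorem mainTheorem3 (D : C -> Prop) (x : R -> R -> V4) (g1 g2 s : C -> C)
  (hD : open (T := C_UniformSpace) D)
  (hx : minimal_space_like_general_type D x)
  (hcan : forall u v, D (u, v) -> canonical_first_type_at x u v)
  (hg1 : holomorphic D g1) (hg2 : holomorphic D g2)
  (hg' : forall z, D z -> (C_derive g1 z * C_derive g2 z)%C <> RtoC 0)
  (hg : forall z, D z -> (g1 z * Cconj (g2 z))%C <> RtoC (-1))
  (hs : holomorphic_sqrt D s (fun z => (C_derive g1 z * C_derive g2 z)%C))
  (hW : forall u v, D (u, v) -> canonical_weierstrass_at x g1 g2 s u v)
  (u v : R) (huv : D (u, v)) :
  let t : C := (u, v) in
  let p : C := (1 + g1 t * Cconj (g2 t))%C in
  let dg1 : C := C_derive g1 t in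
  let dg2 : C := C_derive g2 t in
  let Q : C :=
    (RtoC (-16 * Cmod (dg1 * dg2)) * (dg1 * Cconj dg2)
     / (RtoC (Cmod p ^ 2) * (p * p)))%C in
  coefE x u v = Cmod p ^ 2 / (4 * Cmod (dg1 * dg2)) /\
  coefG x u v = Cmod p ^ 2 / (4 * Cmod (dg1 * dg2)) /\
  gauss_curvature (metric x) u v = Re Q /\
  forall (U : C -> Prop) (n1 n2 : R -> R -> V4),
    open (T := C_UniformSpace) U -> (forall z, U z -> D z) -> U t ->
    oriented_normal_frame x U n1 n2 ->
    normal_curvature x n1 n2 u v = Im Q.
Proof.
  intros t p dg1 dg2 Q.
  destruct hx as [hsm _]. destruct hs as [hs hsq].
  assert (hs0 : forall z, D z -> s z <> RtoC 0).
  { intros z hz e. apply (hg' z hz). rewrite <- hsq, e by trivial. ring. }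
  assert (hp0 : forall z, D z -> (1 + g1 z * Cconj (g2 z))%C <> RtoC 0).
  { intros z hz e. apply (hg z hz).
    transitivity ((1 + g1 z * Cconj (g2 z)) - 1)%C; [ring|]. rewrite e.
    apply injective_projections; simpl; ring. }
  assert (hd := fun a b hab => weierstrass_derivatives D x g1 g2 s a b hD hsm hg1 hg2 hs hs0 hW hab).
  assert (hE : forall a b, D (a, b) -> isothermal_factor x a b
     (Cmod (1 + g1 (a, b) * Cconj (g2 (a, b))) ^ 2 / (4 * Cmod (s (a, b)) ^ 2))).
  { intros a b hab. destruct (hd a b hab) as (e1 & e2 & _). cbv zeta in e1, e2.
    (* Only the identities for psi itself are used, so its derivative is set to 0. *)
    destruct (num_identities (g1 (a, b)) (g2 (a, b)) 0 0) as (k1 & k2 & k3 & _).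
    destruct (dot_turn (/ s (a, b)) _ _ k2 k3) as (m1 & m2 & m3).
    rewrite k1, <- Cmod2_alt, Cmod_inv_sqr in m1, m2 by now apply hs0.
    assert (q1 : 0 < Cmod (s (a, b)) ^ 2) by (apply pow_lt, Cmod_gt_0, hs0; trivial).
    assert (q2 : 0 < Cmod (1 + g1 (a, b) * Cconj (g2 (a, b))) ^ 2)
      by (apply pow_lt, Cmod_gt_0, hp0; trivial).
    unfold isothermal_factor, metric. rewrite e1, e2, m1, m2, m3.
    repeat split; try (unfold Rdiv; rewrite Rinv_mult; ring).
    - rewrite <- m3. unfold dot. ring.
    - apply Rdiv_lt_0_compat; lra. }
  assert (hiso : forall a b, D (a, b) -> isothermal_factor x a b (metric x cu cu a b)).
  { intros a b hab. pose proof (hE a b hab) as e. assert (e' := e). destruct e' as [-> _]. exact e. }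
  assert (hharm : forall a b, D (a, b) ->
     vpd cv (vpd cv x) a b = vscal (-1) (vpd cu (vpd cu x) a b)).
  { intros a b hab. now destruct (hd a b hab) as (_ & _ & _ & _ & e). }
  assert (hn : Cmod (dg1 * dg2) = Cmod (s t) ^ 2).
  { unfold dg1, dg2. rewrite <- hsq by trivial. rewrite Cmod_mult. ring. }
  pose proof (hE u v huv) as (hE1 & hE2 & _). fold t p in hE1, hE2. rewrite <- hn in hE1, hE2.
  destruct (hd u v huv) as (e1 & e2 & e3 & e4 & _). cbv zeta in e1, e2, e3, e4.
  fold t dg1 dg2 in e1, e2, e3, e4.
  destruct (num_identities (g1 t) (g2 t) dg1 dg2) as (k1 & k2 & k3 & k4 & k5 & k6 & k7).
  cbv zeta in k6, k7. fold p in k6, k7.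
  assert (n0 : 0 < Cmod (dg1 * dg2)).
  { apply Cmod_gt_0, hg'. exact huv. }
  assert (q0 : Re (/ s t)%C ^ 2 + Im (/ s t)%C ^ 2 = / Cmod (dg1 * dg2)).
  { rewrite <- Cmod2_alt, Cmod_inv_sqr, hn; [reflexivity|now apply hs0]. }
  assert (p1 : 0 < Cmod p) by (apply Cmod_gt_0, hp0; trivial).
  assert (p0 := pow_lt _ 2 p1).
  set (w := (dg1 * Cconj dg2 * (Cconj p * Cconj p))%C) in *.
  (* 1 / p^2 = (conj p)^2 / |p|^4. *)
  assert (hQ : Q = (RtoC (-16 * Cmod (dg1 * dg2) / (Cmod p ^ 2) ^ 3) * w)%C).
  { assert (pc : (p * Cconj p)%C = RtoC (Cmod p ^ 2)) by (symmetry; apply Cmod2_conj).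
    assert (pz : p <> RtoC 0) by now apply hp0.
    assert (cz : RtoC (Cmod p ^ 2) <> RtoC 0) by (intro c; apply RtoC_inj in c; lra).
    unfold Q, w. unfold Rdiv. rewrite (RtoC_mult (-16 * _)), RtoC_inv, (RtoC_pow (Cmod p ^ 2)).
    transitivity (RtoC (-16 * Cmod (dg1 * dg2)) * (dg1 * Cconj dg2) * ((p * Cconj p) * (p * Cconj p))
       / (RtoC (Cmod p ^ 2) ^ 3 * (p * p)))%C.
    - rewrite pc. field. split; assumption.
    - field. split; assumption.
    - apply pow_nonzero; lra. }
  assert (hre : forall (k : R) z, Re (RtoC k * z)%C = k * Re z) by (intros; unfold Re; simpl; ring).
  assert (him : forall (k : R) z, Im (RtoC k * z)%C = k * Im z) by (intros; unfold Im; simpl; ring).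
  rewrite hQ, hre, him.
  split; [exact hE1|split; [exact hE2|split]].
  - rewrite (gauss_curvature_harmonic D) by trivial.
    rewrite e1, e3, e4, hE1, half_gram_turn, q0, k6 by trivial.
    field. split; lra.
  - intros U n1 n2 hU hUD ht hfr.
    rewrite (normal_curvature_det D U) by auto.
    rewrite e1, e2, e3, e4, hE1, det4_turn, q0, k7.
    field. split; lra.
Qed.
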